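(* Fix $\lambda_1\ge 0$, $\lambda_2>0$, $\tfrac12<\beta<1$ and let $\epsilon=N^{-\beta}$. Let $(c_N)$ be a sequence with $c_N\to\infty$ and $c_N=o(N^{\delta})$ for every $\delta>0$, as $N\to\infty$. Consider the test of $$H_0:\ Z^n\stackrel{\rm i.i.d.}{\sim}{\rm N}(0,1)\quad\text{versus}\quad H_1:\ Z^n\stackrel{\rm i.i.d.}{\sim}(1-\epsilon){\rm N}(0,1)+\epsilon\,{\rm N}(\mu_N,1),\qquad 1\le n\le N .$$ Let $p^n=\Phi(-Z^n)$ and ${\bf p}=(p^1,\ldots,p^N)$. If $\mu_N=\sqrt{2\nu\log N}$ with $\nu>\rho_Z(\beta)$ ($\nu$ fixed), then $$P_0(\ell_N({\bf p})\ge c_N)+P_{\mu_N}(\ell_N({\bf p})<c_N)\to 0\quad\text{as }N\to\infty,$$ where $P_0$ and $P_{\mu_N}$ denote probability under $H_0$ and $H_1$ respectively.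
   Context: $\Phi$ is the standard normal distribution function. For $p\in(0,1]$ let $f_1(p)=\frac{1}{p(2-\log p)^2}-\frac12$ and $f_2(p)=\frac{1}{\sqrt p}-2$. The sparse likelihood score with parameters $\lambda_1\ge0$, $\lambda_2>0$ is $$\ell_N({\bf p})=\sum_{n=1}^N\ell_N(p^n),\qquad \ell_N(p)=\log\Big(1+\tfrac{\lambda_1\log N}{N}f_1(p)+\tfrac{\lambda_2}{\sqrt{N\log N}}f_2(p)\Big)$$ (well defined for all $p\in(0,1]$ once $N$ is large). The detection-boundary constant is $$\rho_Z(\beta)=\begin{cases}\beta-\tfrac12 & \text{if }\tfrac12<\beta<\tfrac34,\\ (1-\sqrt{1-\beta})^2 & \text{if }\tfrac34\le\beta<1.\end{cases}$$ *)

(* Defs.v *)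
From HB Require Import structures.
From mathcomp Require Import all_boot all_order all_algebra.
From mathcomp Require Import all_classical all_reals all_analysis.

Set Implicit Arguments.
Unset Strict Implicit.
Unset Printing Implicit Defensive.

Import Order.TTheory GRing.Theory Num.Theory.
Import numFieldNormedType.Exports.

Local Open Scope classical_set_scope.
Local Open Scope ring_scope.

Definition mutually_independent (R : realType) (d : measure_display)
    (T : measurableType d) (P : probability T R) (I : finType)
    (X : I -> {mfun T >-> R}) : Prop :=
  forall (J : {set I}) (A : I -> set R), (forall i, measurable (A i)) ->
    (P (\bigcap_(i in [set` J]) (X i @^-1` A i))
      = \prod_(i in J) P (X i @^-1` A i))%E.

Definition iid (R : realType) (d : measure_display) (T : measurableType d)
    (P : probability T R) (I : finType) (X : I -> {mfun T >-> R})
    (law : set R -> \bar R) : Prop :=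
  mutually_independent P X /\
  forall i (A : set R), measurable A -> distribution P (X i) A = law A.

(* The second parameter of [normal_prob] is the standard deviation. *)
Definition normal_mixture_law (R : realType) (eps mu : R) : set R -> \bar R :=
  fun A => ((1 - eps)%:E * normal_prob 0 1 A + eps%:E * normal_prob mu 1 A)%E.

Definition Phi (R : realType) (x : R) : R :=
  fine (normal_prob (0 : R) 1 `]-oo, x]).

Definition pvalue (R : realType) (N : nat) (z : 'I_N -> R) : 'I_N -> R :=
  fun n => Phi (- z n).

Definition f1 (R : realType) (p : R) : R :=
  (p * (2 - ln p) ^+ 2)^-1 - 2^-1.

Definition f2 (R : realType) (p : R) : R := (Num.sqrt p)^-1 - 2.

(* [ln] is total and vanishes on nonpositive arguments.  For 0 < p <= 1 the
   argument below is positive once N is large, so that convention only affects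
   finitely many N. *)
Definition score1 (R : realType) (lambda1 lambda2 : R) (N : nat) (p : R) : R :=
  ln (1 + lambda1 * ln N%:R / N%:R * f1 p
        + lambda2 / Num.sqrt (N%:R * ln N%:R) * f2 p).

Definition score (R : realType) (lambda1 lambda2 : R) (N : nat)
    (p : 'I_N -> R) : R :=
  \sum_(n < N) score1 lambda1 lambda2 N (p n).

(* Used only for 1/2 < beta < 1. *)
Definition rhoZ (R : realType) (beta : R) : R :=
  if beta < 3 / 4 then beta - 1 / 2 else (1 - Num.sqrt (1 - beta)) ^+ 2.

(* Main.v *)
Require Import Defs.
From HB Require Import structures.
From mathcomp Require Import all_boot all_order all_algebra.
From mathcomp Require Import all_classical all_reals all_analysis.
From mathcomp Require Import measurable_realfun ring lra.

(** Put a = lambda1 log N / N, b = lambda2 / sqrt (N log N) and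
    X(p) = 1 + a f1(p) + b f2(p), so that exp of the score is the product of
    the X(p^n).

    Both error probabilities are exponential Markov bounds.  A p-value is
    uniform under H0 and f1, f2 integrate to 0 over (0,1], so each factor
    X(p^n) has mean at most 1; by independence so has the product, and the
    score exceeds c with probability at most exp(-c) ([size_le]).  Under H1 the
    same argument for the inverse factors gives
    P(score < c) <= exp(c) (E 1/X)^N ([power_le]), and it remains to see that
    N (1 - E 1/X) outgrows c.

    Since f1 >= -1/2, X(p) is at least k + b / sqrt p with
    k = 1 - 2 b - a / 2.  Two effects compete in E 1/X.
    - Null observations: over uniform p, 1 / (k + b / sqrt p) has an explicit
      primitive, which yields 1 + O(a + b^2 log (1/b)).  After multiplication
      by N this costs only O(log N) ([integral_lr_low_inv_le], [drift_le]).
      The scaling of the weights in N is made for this.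
    - Signals: when Z is at least sqrt (2 s log N) with 0 < s <= 1, the p-value
      is at most N^(-s) and 1/X is below 1/k by about N^((s-1)/2).  Under
      N(mu_N, 1) this happens with probability about N^(-r^2), where
      r = max (sqrt s - sqrt nu, 0)  ([integral_inv_lr_low_signal_le]).
      After multiplication by N epsilon the gain is N^eta up to a factor
      exp (O (sqrt (log N))), with eta = (1 + s) / 2 - beta - r^2 ([gain_ge]).
    Taking the best s, namely min (4 nu, 1), makes eta positive exactly because
    nu > rho_Z(beta) ([detection_exponent]).  So the gain beats the logarithmic
    cost and c_N, which is smaller than every power of N.

    In the final estimates v stands for sqrt (log N) and N for exp (v^2). *)

Set Implicit Arguments.
Unset Strict Implicit.
Unset Printing Implicit Defensive.

Import Order.TTheory GRing.Theory Num.Theory.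
Import numFieldNormedType.Exports.

Local Open Scope classical_set_scope.
Local Open Scope ring_scope.

(** * Expectations of products of independent variables *)

Section independence.
Context (R : realType) (d : measure_display) (T : measurableType d).
Import HBNNSimple.

(** Equality of two measures on the line, tested on indicators, propagates to
    nonnegative functions through simple functions and monotone convergence.
    It serves twice: with W a product of functions of the other variables, to
    factor one variable out of an independent product, and with W a density on
    the line, to turn expectations into Lebesgue integrals. *)
Lemma ge0_integral_density (mu : {measure set T -> \bar R})
    (nu : {measure set R -> \bar R}) (X W : T -> R) (C : R) :
  measurable_fun setT X ->
  measurable_fun setT W -> (forall w, 0 <= W w) -> 0 <= C ->
  (forall A : set R, measurable A ->
    (\int[mu]_w (\1_A (X w) * W w)%:E = C%:E * nu A)%E) ->
  forall h : R -> R, measurable_fun setT h -> (forall x, 0 <= h x) ->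
    (\int[mu]_w (h (X w) * W w)%:E = C%:E * \int[nu]_x (h x)%:E)%E.
Proof.
move=> mX mW W0 C0 indicE h mh h0.
have mEh : measurable_fun setT (fun x : R => (h x)%:E).
  exact/measurable_EFinP.
pose f_ := nnsfun_approx measurableT mEh.
have cf x : (f_ n x)%:E @[n --> \oo] --> (h x)%:E.
  by apply: (cvg_nnsfun_approx measurableT mEh) => // y _; rewrite lee_fin.
have ndf x m n : (m <= n)%N -> f_ m x <= f_ n x.
  by move=> mn; exact/lefP/nd_nnsfun_approx.
have f0 n x : 0 <= f_ n x by [].
have mf n : measurable_fun setT (f_ n : R -> R) by [].
have mfX n : measurable_fun setT (fun w => f_ n (X w)).
  by apply: measurableT_comp.
have -> : (\int[mu]_w (h (X w) * W w)%:E =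
    limn (fun n => \int[mu]_w (f_ n (X w) * W w)%:E))%E.
  rewrite -monotone_convergence//.
  - apply: eq_integral => w _; apply/esym/cvg_lim => //.
    rewrite EFinM; under eq_fun do rewrite EFinM.
    by apply: cvgeZr => //; exact: cf.
  - by move=> n; apply/measurable_EFinP; exact: measurable_funM.
  - by move=> n w _; rewrite lee_fin mulr_ge0.
  - by move=> w _ m n mn; rewrite lee_fin ler_wpM2r// ndf.
rewrite -ge0_integralZl//=; last first.
  by move=> w _; rewrite lee_fin.
have -> : (\int[nu]_x (C%:E * (h x)%:E) =
    limn (fun n => \int[nu]_x (C * f_ n x)%:E))%E.
  rewrite -monotone_convergence//.
  - apply: eq_integral => w _; apply/esym/cvg_lim => //.
    under eq_fun do rewrite EFinM.
    by apply: cvgeZl => //; exact: cf.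
  - by move=> n; apply/measurable_EFinP; exact: measurable_funM.
  - by move=> n w _; rewrite lee_fin mulr_ge0.
  - by move=> w _ m n mn; rewrite lee_fin ler_wpM2l// ndf.
congr (limn _); apply/funext => n.
have mpre r : measurable (f_ n @^-1` [set r]) by [].
have mind' r : measurable_fun setT (\1_(f_ n @^-1` [set r]) : R -> R).
  exact: measurable_indic.
have mind r : measurable_fun setT (fun w => \1_(f_ n @^-1` [set r]) (X w) : R).
  by apply: measurableT_comp => //.
have ind0 r x : 0 <= r * \1_(f_ n @^-1` [set r]) x.
  have := nnfun_muleindic_ge0 (f_ n) r x.
  by rewrite -EFinM lee_fin.
transitivity (\sum_(r \in range (f_ n))
    \int[mu]_w ((r * \1_(f_ n @^-1` [set r]) (X w)) * W w)%:E)%E.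
  rewrite -ge0_integral_fsum//; last 2 first.
  - by move=> r; apply/measurable_EFinP; repeat apply: measurable_funM => //.
  - by move=> r w _; rewrite lee_fin mulr_ge0.
  apply: eq_integral => w _; rewrite (fimfunE (f_ n) (X w)).
  by rewrite fsumEFin//= mulr_fsuml.
transitivity (\sum_(r \in range (f_ n))
    \int[nu]_x (C * (r * \1_(f_ n @^-1` [set r]) x))%:E)%E; last first.
  rewrite -ge0_integral_fsum//; last 2 first.
  - by move=> r; apply/measurable_EFinP; repeat apply: measurable_funM => //.
  - by move=> r w _; rewrite lee_fin mulr_ge0.
  apply: eq_integral => w _; rewrite (fimfunE (f_ n) w).
  by rewrite fsumEFin//= mulr_fsumr.
apply: eq_fsbigr => r /[!inE] -[x _ rE].
have r0 : 0 <= r by rewrite -rE.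
under eq_integral do rewrite -mulrA EFinM.
rewrite ge0_integralZl//; last 2 first.
- by apply/measurable_EFinP; exact: measurable_funM.
- by move=> w _; rewrite lee_fin mulr_ge0.
rewrite indicE//.
under [RHS]eq_integral do rewrite mulrCA EFinM.
rewrite ge0_integralZl//; last 2 first.
- by apply/measurable_EFinP; apply: measurable_funM.
- by move=> w _; rewrite lee_fin mulr_ge0.
congr (_ * _)%E; under [RHS]eq_integral do rewrite EFinM.
rewrite ge0_integralZl//; first by rewrite integral_indic// setIT.
exact/measurable_EFinP.
Qed.

Lemma measurable_prod (D : set T) (I : Type) (s : seq I) (p : pred I)
    (h : I -> T -> R) :
  (forall i, measurable_fun D (h i)) ->
  measurable_fun D (fun w => \prod_(i <- s | p i) h i w).
Proof.
move=> mh; elim: s => [|i s IHs].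
  rewrite (_ : (fun w => _) = cst 1); last first.
    by apply/funext => w; rewrite big_nil.
  exact: measurable_cst.
have [pi|pi] := boolP (p i).
- rewrite (_ : (fun w => _) =
      (fun w => h i w * \prod_(j <- s | p j) h j w)).
    exact: measurable_funM.
  by apply/funext => w; rewrite big_cons pi.
- rewrite (_ : (fun w => _) = (fun w => \prod_(j <- s | p j) h j w))//.
  by apply/funext => w; rewrite big_cons (negbTE pi).
Qed.

(** Independence is the product rule for indicators.  The indicators are
    replaced one coordinate at a time by nonnegative functions: while the other
    coordinates are fixed, both sides are measures in the set of the current
    one. *)
Lemma integral_prod_independent (P : probability T R) (I : finType)
    (X : I -> {mfun T >-> R}) (h : I -> R -> R) :
  mutually_independent P X ->
  (forall i, measurable_fun setT (h i)) -> (forall i x, 0 <= h i x) ->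
  (forall i, (\int[P]_w (h i (X i w))%:E < +oo)%E) ->
  (\int[P]_w (\prod_i h i (X i w))%:E = \prod_i \int[P]_w (h i (X i w))%:E)%E.
Proof.
move=> indep.
(* [s] lists the coordinates whose function need not be an indicator. *)
suff step (s : seq I) : forall h : I -> R -> R,
    (forall i, measurable_fun setT (h i)) -> (forall i x, 0 <= h i x) ->
    (forall i, (\int[P]_w (h i (X i w))%:E < +oo)%E) ->
    (forall i, i \notin s -> exists2 A, measurable A & h i = \1_A) ->
  (\int[P]_w (\prod_i h i (X i w))%:E = \prod_i \int[P]_w (h i (X i w))%:E)%E.
  by move=> mh h0 hoo; apply: (step (enum I)) => // i; rewrite mem_enum.
elim: s => [|i s IHs] {}h mh h0 hoo hind.
- have [A Ah] : exists A : I -> set R,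
      forall i, measurable (A i) /\ h i = \1_(A i).
    have /boolp.choice[A AP] : forall i, exists A, measurable A /\ h i = \1_A.
      by move=> i; have [A] := hind i isT; exists A.
    by exists A.
  have mA i : measurable (A i) by case: (Ah i).
  have hE i : h i = \1_(A i) by case: (Ah i).
  have mXA i : measurable (X i @^-1` A i).
    by rewrite -[X in measurable X]setTI; exact: measurable_funP.
  have := indep [set: I]%SET A mA.
  rewrite (eq_bigl xpredT); last by move=> i; rewrite inE.
  rewrite (eq_bigr (fun i => \int[P]_w (h i (X i w))%:E)%E); last first.
    move=> i _; rewrite -(setIT (X i @^-1` A i)) -integral_indic//.
    by apply: eq_integral => w _; rewrite hE.
  move=> <-.
  set B := \bigcap_(_ in _) _.
  have mB : measurable B.
    by apply: fin_bigcap_measurable => //; exact: finite_finset.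
  rewrite -(setIT B) -integral_indic//; apply: eq_integral => w _; congr EFin.
  under eq_bigr do rewrite hE.
  rewrite !indicE; have [Bw|nBw] := boolP (w \in B).
    rewrite big1// => i _; rewrite indicE mem_set//.
    by move: Bw; rewrite inE => /(_ i); apply => /=; rewrite inE.
  move: nBw; rewrite notin_setE => nBw.
  have [i nAi] : exists i, ~ A i (X i w).
    by apply/not_existsP => H; apply: nBw => i _; have := H i; exact: contrapT.
  by rewrite (bigD1 i)//= indicE memNset// mul0r.
- pose W w := \prod_(j | j != i) h j (X j w).
  pose E j := fine (\int[P]_w (h j (X j w))%:E)%E.
  have int0 j : (0 <= \int[P]_w (h j (X j w))%:E)%E.
    by apply: integral_ge0 => w _; rewrite lee_fin.
  have EE j : (\int[P]_w (h j (X j w))%:E = (E j)%:E)%E.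
    by rewrite fineK// ge0_fin_numE.
  pose C := \prod_(j | j != i) E j.
  have mW : measurable_fun setT W.
    by apply: measurable_prod => j; apply: measurableT_comp.
  have W0 w : 0 <= W w by apply: prodr_ge0.
  have C0 : 0 <= C by apply: prodr_ge0 => j _; exact/fine_ge0.
  have -> : (\prod_i \int[P]_w (h i (X i w))%:E =
             C%:E * \int[P]_w (h i (X i w))%:E)%E.
    rewrite (bigD1 i)//= muleC; congr (_ * _)%E.
    by rewrite /C -prodEFin; apply: eq_bigr => j _; rewrite EE.
  under eq_integral do rewrite (bigD1 i)//=.
  rewrite -(@ge0_integral_distribution _ _ _ _ _ P (X i)
    (fun x => (h i x)%:E))//;
    [|by apply/measurable_EFinP|by move=> x; rewrite lee_fin].
  apply: (ge0_integral_density (W := W)) => // A mA.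
  transitivity (C%:E * \int[P]_w (\1_A (X i w))%:E)%E; last first.
    congr (_ * _)%E; rewrite -[RHS]/(P (X i @^-1` A)).
    have mXA : measurable (X i @^-1` A).
      by rewrite -[X in measurable X]setTI; exact: measurable_funP.
    by rewrite -(setIT (X i @^-1` A)) -integral_indic.
  pose h' j := if j == i then \1_A else h j.
  have h'i : h' i = \1_A by rewrite /h' eqxx.
  have h'j j : j != i -> h' j = h j by rewrite /h' => /negbTE ->.
  have := IHs h'.
  rewrite (bigD1 i)//= h'i muleC.
  rewrite (eq_bigr (fun j => (E j)%:E)); last by move=> j /h'j ->; exact: EE.
  rewrite prodEFin => <-.
  + apply: eq_integral => w _; congr EFin; rewrite (bigD1 i)//= h'i.
    by congr (_ * _); apply: eq_bigr => j /h'j ->.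
  + by move=> j; rewrite /h'; case: ifP.
  + by move=> j x; rewrite /h'; case: ifP.
  + move=> j; have [->|ji] := eqVneq j i; last by rewrite h'j.
    rewrite h'i; apply: (@le_lt_trans _ _ (\int[P]_w 1%:E)%E).
      apply: ge0_le_integral => //.
      * by apply/measurable_EFinP; apply: measurableT_comp.
      * by move=> w _; rewrite lee_fin indicE; case: (_ \in _).
    by rewrite integral_cst// mul1e (le_lt_trans (probability_le1 P _))// ltry.
  + move=> j js; rewrite /h'; case: ifPn => [_|ji]; first by exists A.
    by apply: hind; rewrite inE negb_or ji.
Qed.

(** Markov's inequality for a product of independent factors; both error
    bounds of the test come from it. *)
Lemma prob_le_prod_independent (P : probability T R) (I : finType)
    (X : I -> {mfun T >-> R}) (g : R -> R) (m K : R) (E : set T) :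
  mutually_independent P X ->
  measurable_fun setT g -> (forall x, 0 <= g x) ->
  (forall i, (\int[P]_w (g (X i w))%:E <= m%:E)%E) ->
  0 < K -> measurable E -> (forall w, E w -> K <= \prod_i g (X i w)) ->
  (P E <= (m ^+ #|I| / K)%:E)%E.
Proof.
move=> indep mg g0 gm K0 mE KE.
have int0 i : (0 <= \int[P]_w (g (X i w))%:E)%E.
  by apply: integral_ge0 => w _; rewrite lee_fin.
rewrite EFinM muleC lee_pdivlMl//.
have -> : (P E = \int[P]_w (\1_E w)%:E)%E by rewrite integral_indic// setIT.
rewrite -ge0_integralZl//; last 2 first.
- by apply/measurable_EFinP.
- by rewrite lee_fin ltW.
have mXg i : measurable_fun setT (fun w => g (X i w)).
  exact: measurableT_comp.
apply: (@le_trans _ _ (\int[P]_w (\prod_i g (X i w))%:E)%E).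
  apply: ge0_le_integral => //.
  - by move=> w _; rewrite -EFinM lee_fin mulr_ge0// ltW.
  - by apply: measurable_funeM; exact/measurable_EFinP.
  - by apply/measurable_EFinP; exact: measurable_prod.
  - move=> w _; rewrite -EFinM lee_fin indicE.
    have [/[!inE] /KE|_] := boolP (w \in E); first by rewrite mulr1.
    by rewrite mulr0; apply: prodr_ge0.
rewrite (integral_prod_independent (h := fun=> g))//; last first.
  by move=> i; rewrite (le_lt_trans (gm i))// ltry.
rewrite -prodr_const -prodEFin.
suff [] : (0 <= \prod_i \int[P]_w (g (X i w))%:E <= \prod_(i in I) m%:E)%E.
  by case/andP.
elim/big_ind2 : _ => [|x1 x2 y1 y2 /andP[? ?] /andP[? ?]|i _].
- by rewrite lexx lee_fin ler01.
- by rewrite mule_ge0//= lee_pmul.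
- by rewrite int0 gm.
Qed.

End independence.

(** * The standard normal distribution function *)

Section gaussian.
Context (R : realType).
Local Notation mu := (@lebesgue_measure R).
Local Notation phi := (normal_pdf (0 : R) 1).

Lemma ge0_integral_law_density (d : measure_display) (T : measurableType d)
    (P : probability T R) (X : {mfun T >-> R}) (f g : R -> R) :
  measurable_fun setT f -> (forall x, 0 <= f x) ->
  (forall A : set R, measurable A ->
    distribution P X A = \int[mu]_(x in A) (f x)%:E)%E ->
  measurable_fun setT g -> (forall x, 0 <= g x) ->
  (\int[P]_w (g (X w))%:E = \int[mu]_x (g x * f x)%:E)%E.
Proof.
move=> mf f0 law mg g0.
rewrite -(@ge0_integral_distribution _ _ _ _ _ P X
  (fun x => (g x)%:E))//; last first.
  exact/measurable_EFinP.
have lawE (A : set R) : measurable A ->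
    (\int[mu]_x (\1_A (idfun x) * f x)%:E = 1%:E * distribution P X A)%E.
  move=> mA; rewrite mul1e law// [RHS]integral_mkcond.
  apply: eq_integral => x _; rewrite patchE indicE.
  by case: ifPn => _; rewrite /= ?mul1r ?mul0r.
have mid : @measurable_fun _ _ (measurableTypeR R) R setT idfun.
  exact: measurable_id.
have /(_ g mg g0) := @ge0_integral_density R _ (measurableTypeR R) mu
  (distribution P X) idfun f 1 mid mf f0 ler01 lawE.
by rewrite mul1e => <-.
Qed.

Lemma normal_pdf_gt0 (m s : R) x : s != 0 -> 0 < normal_pdf m s x.
Proof.
move=> s0; rewrite normal_pdfE//= mulr_gt0 ?normal_peak_gt0//.
exact: expR_gt0.
Qed.

Lemma normal_pdf_even (x : R) : phi (- x) = phi x.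
Proof. by rewrite normal_pdfE ?oner_eq0//= /normal_fun !subr0 sqrrN. Qed.

Lemma PhiE (x : R) : ((Phi x)%:E = \int[mu]_(t in `]-oo, x]) (phi t)%:E)%E.
Proof.
rewrite /Phi fineK// ge0_fin_numE ?measure_ge0//.
by rewrite (le_lt_trans (probability_le1 _ _))// ltry.
Qed.

Lemma Phi_le1 (x : R) : Phi x <= 1.
Proof.
by rewrite -lee_fin PhiE; exact: (@probability_le1 _ _ _ (normal_prob 0 1)).
Qed.

Lemma normal_prob_itv_ge (m a b r : R) : a <= b ->
  (forall t, a <= t <= b -> `|t - m| <= r) ->
  ((phi r * (b - a))%:E <= \int[mu]_(t in `[a, b]) (normal_pdf m 1 t)%:E)%E.
Proof.
move=> ab abr.
have -> : ((phi r * (b - a))%:E = \int[mu]_(t in `[a, b]) (phi r)%:E)%E.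
  by rewrite integral_cst//= lebesgue_measure_itv/= lte_fin -EFinD;
    case: ltP => // ba; have -> : b = a by [apply/le_anti; rewrite ba ab];
    rewrite subrr mulr0 mule0.
apply: ge0_le_integral => //.
- by move=> t _; rewrite lee_fin normal_pdf_ge0.
- by apply/measurable_EFinP/measurable_funTS; exact: measurable_normal_pdf.
move=> t /=; rewrite in_itv/= => /abr tr.
rewrite lee_fin !normal_pdfE ?oner_eq0//= ler_wpM2l ?normal_peak_ge0//.
rewrite ler_expR ler_wpM2r//.
rewrite subr0 lerN2 -(real_normK (num_real (t - m))) ler_sqr ?nnegrE//.
exact: le_trans tr.
Qed.

Lemma Phi_gt0 (x : R) : 0 < Phi x.
Proof.
rewrite -lte_fin PhiE.
pose r := `|x| + 1.
apply: (@lt_le_trans _ _ (phi r * (x - (x - 1)))%R%:E).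
  by rewrite lte_fin opprB addrCA subrr addr0 mulr1 normal_pdf_gt0 ?oner_eq0.
apply: (@le_trans _ _ (\int[mu]_(t in `[(x - 1)%R, x]) (phi t)%:E)%E).
  apply: normal_prob_itv_ge; first by rewrite gerBl.
  move=> t /andP[xt tx]; rewrite subr0 ler_norml.
  have := ler_norm x; have := ler_normr x x; rewrite lexx /r.
  have := ler_norm (- x); rewrite normrN; lra.
apply: ge0_subset_integral => //.
- by apply/measurable_EFinP/measurable_funTS; exact: measurable_normal_pdf.
- by move=> t _; rewrite lee_fin normal_pdf_ge0.
- by move=> t /=; rewrite !in_itv/= => /andP[].
Qed.

(** For t <= - x with x >= 0 one has t^2 >= x^2 + (t + x)^2, so the standard
    density is at most exp (- x^2 / 2) times the density centred at - x, whose
    mass is at most 1. *)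
Lemma PhiN_le (x : R) : 0 <= x -> Phi (- x) <= expR (- (x ^+ 2 / 2)).
Proof.
move=> x0; rewrite -lee_fin PhiE.
have mp m : @measurable_fun _ _ (measurableTypeR R) _ setT
    (fun t => (normal_pdf m 1 t)%:E).
  by apply/measurable_EFinP; exact: measurable_normal_pdf.
apply: (@le_trans _ _ (\int[mu]_(t in `]-oo, (- x)%R])
    ((expR (- (x ^+ 2 / 2)))%:E * (normal_pdf (- x)%R 1 t)%:E))%E).
  apply: ge0_le_integral => //.
  - by move=> t _; rewrite lee_fin normal_pdf_ge0.
  - by apply: measurable_funTS; exact: mp.
  - by apply: measurable_funeM; apply: measurable_funTS; exact: mp.
  move=> t /=; rewrite in_itv/= => tx.
  rewrite -EFinM lee_fin !normal_pdfE ?oner_eq0//= mulrCA.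
  rewrite ler_wpM2l ?normal_peak_ge0// -expRD ler_expR subr0 expr1n.
  nra.
rewrite ge0_integralZl//=; last 2 first.
- by apply: measurable_funTS; exact: mp.
- by move=> t _; rewrite lee_fin normal_pdf_ge0.
rewrite -[leRHS]mule1 lee_wpmul2l ?lee_fin ?expR_ge0//.
exact: (@probability_le1 _ _ _ (normal_prob (- x) 1)).
Qed.

Lemma is_derive_Phi (x : R) : is_derive x 1 (@Phi R) (phi x).
Proof.
have xx1 : x < x + 1 by rewrite ltrDl.
have iphi : mu.-integrable [set` Interval -oo%O (BRight (x + 1))] (EFin \o phi).
  by apply: (integrableS _ _ (@subsetT _ _)) => //;
    exact: integrable_normal_pdf.
have [||dPhi PhiE'] := continuous_FTC1 xx1 iphi.
- exact: ltNyr.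
- exact: continuous_normal_pdf.
by apply: DeriveDef; [exact: dPhi|rewrite -derive1E PhiE'].
Qed.

Lemma continuous_Phi : continuous (@Phi R).
Proof.
move=> x; apply: differentiable_continuous; apply/derivable1_diffP.
by have [] := is_derive_Phi x.
Qed.

End gaussian.

(** * Integration against the law of a p-value *)

Section pvalue_integral.
Context (R : realType).
Local Notation mu := (@lebesgue_measure R).
Local Notation phi := (normal_pdf (0 : R) 1).

Lemma is_derive_continuous (f : R -> R) (x a : R) :
  is_derive x 1 f a -> {for x, continuous f}.
Proof. by case=> df _; apply/differentiable_continuous/derivable1_diffP. Qed.

Lemma measurable_PhiN : measurable_fun setT (fun z : R => Phi (- z)).
Proof.
apply: (measurableT_comp (f := @Phi R)); last exact: oppr_measurable.
by apply: continuous_measurable_fun; exact: continuous_Phi.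
Qed.

(** The substitution p = Phi (- z): - H (Phi (- z)) is a primitive of the
    integrand.  It is applied on the compact intervals [-n, n] so that [h] may
    be unbounded near p = 0, and bounds on [H] replace its limits there. *)
Lemma integral_comp_PhiN_le (h H : R -> R) (m M : R) :
  measurable_fun setT h -> (forall p : R, 0 <= p -> 0 <= h p) ->
  (forall p : R, 0 < p <= 1 -> is_derive p 1 H (h p)) ->
  (forall p : R, 0 < p <= 1 -> {for p, continuous h}) ->
  (forall p : R, 0 < p <= 1 -> m <= H p <= M) ->
  (\int[mu]_z (h (Phi (- z)) * phi z)%:E <= (M - m)%:E)%E.
Proof.
move=> mh h0 dH ch Hm.
have Phi01 (z : R) : 0 < Phi z <= 1 by rewrite Phi_gt0 Phi_le1.
pose g z := h (Phi (- z)) * phi z.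
have mg : measurable_fun setT g.
  apply: measurable_funM; last exact: measurable_normal_pdf.
  by apply: measurableT_comp => //; exact: measurable_PhiN.
have g0 z : 0 <= g z.
  by rewrite mulr_ge0 ?normal_pdf_ge0// h0 ?ltW ?Phi_gt0.
pose G z := - H (Phi (- z)).
have dPhiN (z : R) : is_derive z 1 (fun t => Phi (- t)) (- phi z).
  have := @is_derive1_comp _ (@Phi R) -%R z _ _ (is_derive_Phi (- z))
    (is_deriveNid z 1).
  by rewrite normal_pdf_even mulrN1.
have dG (z : R) : is_derive z 1 G (g z).
  have := @is_derive1_comp _ H _ z _ _ (dH _ (Phi01 (- z))) (dPhiN z).
  move=> /is_deriveN; rewrite mulrN opprK.
  exact.
have cg : continuous g.
  move=> z; apply: continuousM; last exact: continuous_normal_pdf.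
  apply: (@continuous_comp _ _ _ (fun t => Phi (- t)) h).
    exact: is_derive_continuous (dPhiN z).
  exact: ch.
have cG : continuous G by move=> z; exact: is_derive_continuous (dG z).
have intn n : (\int[mu]_(z in `[(- n%:R)%R, n%:R]) (g z)%:E <= (M - m)%:E)%E.
  have [->|n0] := posnP n.
    rewrite oppr0 set_itv1 integral_set1 lee_fin.
    have /andP[mH HM] : m <= H 1 <= M by apply: Hm; rewrite ltr01 lexx.
    by rewrite subr_ge0 (le_trans mH).
  rewrite (continuous_FTC2 (F := G)).
  - rewrite -EFinB lee_fin /G !opprK.
    have /andP[? ?] := Hm _ (Phi01 (- n%:R)).
    have /andP[? ?] := Hm _ (Phi01 n%:R); lra.
  - by rewrite gtrN// ltr0n.
  - exact: continuous_subspaceT.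
  - split.
    + by move=> z _; case: (dG z).
    + by apply: cvg_at_right_filter; exact: cG.
    + by apply: cvg_at_left_filter; exact: cG.
  - by move=> z _; rewrite derive1E; case: (dG z).
pose I (n : nat) : set R := `[(- n%:R)%R, n%:R]%classic.
have := @ge0_nondecreasing_set_cvg_integral _ (measurableTypeR R) R I
  (EFin \o g) mu.
rewrite (bigcup_itvT true false) => cvg_int.
apply: cvge_le (cvg_int _ _ _ _).
- by apply: nearW => n; exact: intn.
- move=> i j ij; rewrite subsetEset => z; rewrite /I/= !in_itv/=.
  move=> /andP[iz zi]; rewrite (le_trans _ iz) ?(le_trans zi) ?ler_nat//.
  by rewrite lerN2 ler_nat.
- by move=> i; exact: measurable_itv.
- by move=> i; apply/measurable_EFinP/measurable_funTS.
- by move=> i z _; rewrite lee_fin.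
Qed.

End pvalue_integral.

(** * Moments of one factor of the likelihood ratio *)

Section score_moments.
Context (R : realType).
Local Notation mu := (@lebesgue_measure R).
Local Notation phi := (normal_pdf (0 : R) 1).
Implicit Types p a b k : R.

(** x (x^2)^(-1) equals the inverse of x even at 0, and it inverts a
    nonnegative number only, for which the inverse is a real power. *)
Lemma measurable_inv : measurable_fun setT (@GRing.inv R).
Proof.
rewrite (_ : GRing.inv = fun x : R => x * (x ^+ 2) `^ (-1)); last first.
  apply/funext => x; rewrite powR_inv1 ?sqr_ge0//.
  have [->|x0] := eqVneq x 0; first by rewrite invr0 mul0r.
  by rewrite expr2 invfM mulVKf.
apply: measurable_funM => //.
apply: (measurableT_comp (f := fun y : R => y `^ (-1))).
  exact: measurable_powR.
exact: measurable_funX.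
Qed.

Lemma measurable_sqrt : measurable_fun setT (@Num.sqrt R).
Proof. by apply: continuous_measurable_fun; exact: sqrt_continuous. Qed.

Lemma measurable_f1 : measurable_fun setT (@f1 R).
Proof.
apply: measurable_funB => //; apply: (measurableT_comp measurable_inv).
apply: measurable_funM => //; apply: measurable_funX.
by apply: measurable_funB => //; exact: measurable_ln.
Qed.

Lemma measurable_f2 : measurable_fun setT (@f2 R).
Proof.
apply: measurable_funB => //; apply: (measurableT_comp measurable_inv).
exact: measurable_sqrt.
Qed.

(** The density of p-values, relative to the uniform one, whose logarithm is
    the score of a single observation. *)
Definition lr a b p := 1 + a * f1 p + b * f2 p.

Lemma measurable_lr a b : measurable_fun setT (lr a b).
Proof.
apply: measurable_funD; [apply: measurable_funD => //|];
  apply: measurable_funM => //; [exact: measurable_f1|exact: measurable_f2].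
Qed.

Lemma lr_ge a b p : 0 <= a -> 0 <= p ->
  1 - 2 * b - a / 2 + b / Num.sqrt p <= lr a b p.
Proof.
move=> a0 p0; rewrite /lr /f1 /f2.
have : 0 <= a * (p * (2 - ln p) ^+ 2)^-1.
  by rewrite mulr_ge0// invr_ge0 mulr_ge0// sqr_ge0.
lra.
Qed.

(** A p-value is uniform under the standard normal law, and 1 / (2 - ln p) and
    2 sqrt p are primitives of 1 / (p (2 - ln p)^2) and 1 / sqrt p. *)
Lemma integral_lr_le1 a b : 0 <= a -> 0 <= b -> 2 * b + a / 2 <= 1 ->
  (\int[mu]_z (lr a b (Phi (- z)) * phi z)%:E <= 1)%E.
Proof.
move=> a0 b0 ab.
pose H p := (1 - 2 * b - a / 2) * p + a * (2 - ln p)^-1 + 2 * b * Num.sqrt p.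
have dH p : 0 < p <= 1 -> is_derive p 1 H (lr a b p).
  move=> /andP[p0 p1]; have l0 : 2 - ln p != 0 by have := ln_le0 p1; lra.
  have s0 : Num.sqrt p != 0 by rewrite gt_eqF// sqrtr_gt0.
  have dl := is_derive1_ln p0; have ds := is_derive1_sqrt p0.
  have d2l : is_derive p 1 (fun q : R => 2 - ln q) (- p^-1).
    by have := is_deriveB (is_derive_cst (2 : R^o) p 1) dl; rewrite sub0r.
  have dH := is_deriveD (is_deriveD (is_deriveZ (1 - 2 * b - a / 2)
    (is_derive_id (p : R^o) 1)) (is_deriveZ a
    (is_deriveV (f := fun q : R => 2 - ln q) l0 d2l)))
    (is_deriveZ (2 * b) ds).
  apply: (is_derive_eq dH).
  rewrite /lr /f1 /f2 /GRing.scale/=.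
  field.
  by rewrite s0 l0 gt_eqF.
have cX p : 0 < p <= 1 -> {for p, continuous (lr a b)}.
  move=> /andP[p0 p1].
  have l0 : 2 - ln p != 0 by have := ln_le0 p1; lra.
  have s0 : Num.sqrt p != 0 by rewrite gt_eqF// sqrtr_gt0.
  have cl : {for p, continuous (fun q : R => 2 - ln q)}.
    by apply: continuousB; [exact: cst_continuous|exact: continuous_ln].
  apply: continuousD; [apply: continuousD; [exact: cst_continuous|]|];
    (apply: continuousM; [exact: cst_continuous|]);
    (apply: continuousB; [|exact: cst_continuous]).
  - apply: (continuousV (s := fun q : R => q * (2 - ln q) ^+ 2)).
      by rewrite mulf_neq0 ?sqrf_eq0// gt_eqF.
    by apply: continuousM => //; apply: continuousM.
  - by apply: continuousV => //; exact: sqrt_continuous.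
have := @integral_comp_PhiN_le R (lr a b) H 0 1 (measurable_lr a b) _ dH cX.
rewrite subr0; apply.
- move=> p p0; apply: le_trans (lr_ge b a0 p0).
  have : 0 <= b / Num.sqrt p by rewrite divr_ge0// sqrtr_ge0.
  lra.
- move=> p /andP[p0 p1].
  have l0 := ln_le0 p1.
  have l1 : 0 < (2 - ln p)^-1 by rewrite invr_gt0; lra.
  have l2 : (2 - ln p)^-1 <= 2^-1 by rewrite lef_pV2 ?posrE; lra.
  have s0 := sqrtr_ge0 p.
  have s1 : Num.sqrt p <= 1 by rewrite -sqrtr1 ler_sqrt.
  rewrite /H; nra.
Qed.

(** With u = sqrt p, the integral over uniform p is that of
    2 u^2 / (k u + b) over [0, 1], which is (k - 2 b) / k^2 plus the correction
    2 b^2 / k^3 ln ((k + b) / b).  As k >= 1/2 and k + b <= 1, that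
    correction is at most - 16 b^2 ln b.  The term 8 b^2 is slack, left by a
    crude lower bound of the primitive. *)
Lemma integral_lr_low_inv_le b k :
  0 < b -> 2^-1 <= k <= 1 -> 2 * b <= k -> k + b <= 1 ->
  (\int[mu]_z ((k + b / Num.sqrt (Phi (- z)))^-1 * phi z)%:E <=
    ((k - 2 * b) / k ^+ 2 + 8 * b ^+ 2 - 16 * b ^+ 2 * ln b)%:E)%E.
Proof.
move=> b0 /andP[k2 k1] bk kb.
have k0 : 0 < k by lra.
pose h p := (k + b / Num.sqrt p)^-1.
pose c := 2 * b ^+ 2 / k ^+ 3.
pose H p := p / k - 2 * b / k ^+ 2 * Num.sqrt p + c * ln (k * Num.sqrt p + b).
have dH p : 0 < p <= 1 -> is_derive p 1 H (h p).
  move=> /andP[p0 p1]; have s0 : 0 < Num.sqrt p by rewrite sqrtr_gt0.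
  have kb0 : 0 < k * Num.sqrt p + b by rewrite addr_gt0// mulr_gt0.
  have ds := is_derive1_sqrt p0.
  have di : is_derive p 1 (fun q : R => k * Num.sqrt q + b)
      (k * (2 * Num.sqrt p)^-1).
    have := is_deriveD (is_deriveZ k ds) (is_derive_cst (b : R^o) p 1).
    by rewrite addr0.
  have dl := is_derive1_comp (f := @ln R)
    (g := fun q : R => k * Num.sqrt q + b) (is_derive1_ln kb0) di.
  have dH := is_deriveD (is_deriveB (is_deriveZ k^-1 (is_derive_id (p : R^o) 1))
    (is_deriveZ (2 * b / k ^+ 2) ds)) (is_deriveZ c dl).
  have -> : H = (k^-1 *: id - (2 * b / k ^+ 2) *: Num.sqrt +
     c *: (@ln R \o (fun q : R => k * Num.sqrt q + b))).
    by apply/funext => q; rewrite /H mulrC.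
  apply: (is_derive_eq dH).
  rewrite /h /c /GRing.scale/=.
  field.
  by rewrite !gt_eqF// ?addr_gt0// divr_gt0.
have ch p : 0 < p <= 1 -> {for p, continuous h}.
  move=> /andP[p0 p1]; have s0 : 0 < Num.sqrt p by rewrite sqrtr_gt0.
  apply: (continuousV (s := fun q : R => k + b / Num.sqrt q)).
    by rewrite gt_eqF// addr_gt0// divr_gt0.
  apply: continuousD; first exact: cst_continuous.
  apply: continuousM; first exact: cst_continuous.
  by apply: continuousV; [rewrite gt_eqF|exact: sqrt_continuous].
have mh : measurable_fun setT h.
  apply: (measurableT_comp measurable_inv).
  apply: measurable_funD => //; apply: measurable_funM => //.
  by apply: (measurableT_comp measurable_inv); exact: measurable_sqrt.
pose m := - (b ^+ 2 / k ^+ 3) + c * ln b.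
pose M := (1 - 2 * b / k) / k.
have c0 : 0 <= c by rewrite divr_ge0// ?exprn_ge0 ?(ltW k0)// mulr_ge0 ?sqr_ge0.
have HmM p : 0 < p <= 1 -> m <= H p <= M.
  move=> /andP[p0 p1].
  have s0 : 0 < Num.sqrt p by rewrite sqrtr_gt0.
  have s1 : Num.sqrt p <= 1 by rewrite -sqrtr1 ler_sqrt.
  rewrite /H -{1 4}(sqr_sqrtr (ltW p0)).
  set u := Num.sqrt p in s0 s1 *.
  have ku0 : 0 < k * u by rewrite mulr_gt0.
  have lb : c * ln b <= c * ln (k * u + b).
    by rewrite ler_wpM2l// ler_ln ?posrE; lra.
  have lM : c * ln (k * u + b) <= 0.
    rewrite mulr_ge0_le0// ln_le0//.
    have : k * u <= k by rewrite ger_pMr.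
    lra.
  (* The polynomial part of the primitive is (u^2 - 2 t u) / k: it is at least
     - t^2 / k, and it is largest at u = 1 because t <= 1 / 2. *)
  set t := b / k.
  have t2 : 2 * t <= 1 by rewrite /t mulrA ler_pdivrMr// mul1r.
  have t0 : 0 < t by rewrite divr_gt0.
  have e1 : u ^+ 2 / k - 2 * b / k ^+ 2 * u = (u ^+ 2 - 2 * t * u) / k.
    by rewrite /t; field; rewrite gt_eqF.
  have e2 : b ^+ 2 / k ^+ 3 = t ^+ 2 / k by rewrite /t; field; rewrite gt_eqF.
  have e3 : M = (1 - 2 * t) / k by rewrite /M /t mulrA.
  rewrite /m e1 e2 e3; apply/andP; split.
  - have : - (t ^+ 2 / k) <= (u ^+ 2 - 2 * t * u) / k.
      rewrite -mulNr ler_pM2r ?invr_gt0//.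
      by have := sqr_ge0 (u - t); nra.
    lra.
  - have : (u ^+ 2 - 2 * t * u) / k <= (1 - 2 * t) / k.
      rewrite ler_pM2r ?invr_gt0//; nra.
    lra.
have h0 p : 0 <= p -> 0 <= h p.
  by move=> p0; rewrite invr_ge0 addr_ge0 ?divr_ge0 ?sqrtr_ge0// ltW.
apply: le_trans (integral_comp_PhiN_le mh h0 dH ch HmM) _.
rewrite lee_fin /M /m /c.
have lb0 : ln b <= 0 by rewrite ln_le0//; lra.
have k3 : k ^- 3 <= 8.
  have k3 : 1 <= 8 * k ^+ 3.
    have -> : 8 * k ^+ 3 = (2 * k) ^+ 3 by ring.
    by rewrite exprn_ege1//; lra.
  by rewrite -[leLHS]mul1r ler_pdivrMr// exprn_gt0.
have b2 : 0 <= b ^+ 2 by exact: sqr_ge0.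
have -> : (1 - 2 * b / k) / k = (k - 2 * b) / k ^+ 2.
  by field; rewrite gt_eqF.
have e1 : b ^+ 2 / k ^+ 3 <= 8 * b ^+ 2 by rewrite mulrC ler_wpM2r.
have e2 : b ^+ 2 / k ^+ 3 * - ln b <= 8 * b ^+ 2 * - ln b.
  by rewrite ler_wpM2r// oppr_ge0.
rewrite -mulrA.
nra.
Qed.

End score_moments.

Section tests.
Context (R : realType).
Local Notation mu := (@lebesgue_measure R).
Local Notation phi := (normal_pdf (0 : R) 1).
Implicit Types a b k eps : R.

(** An upper bound for 1 / lr, as a function of the observation z: only f2
    detects the signal, f1 is bounded below by - 1 / 2 inside [k]. *)
Definition inv_lr_low b k (z : R) : R := (k + b / Num.sqrt (Phi (- z)))^-1.

Lemma measurable_inv_lr_low b k : measurable_fun setT (inv_lr_low b k).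
Proof.
apply: (measurableT_comp (@measurable_inv R)).
apply: measurable_funD => //; apply: measurable_funM => //.
apply: (measurableT_comp (@measurable_inv R)).
apply: (measurableT_comp (@measurable_sqrt R)).
exact: measurable_PhiN.
Qed.

Lemma inv_lr_low_ge0 b k z : 0 <= b -> 0 <= k -> 0 <= inv_lr_low b k z.
Proof.
by move=> b0 k0; rewrite invr_ge0 addr_ge0// divr_ge0// sqrtr_ge0.
Qed.

Lemma inv_lr_low_le b k z : 0 <= b -> 0 < k -> inv_lr_low b k z <= k^-1.
Proof.
move=> b0 k0; have bs : 0 <= b / Num.sqrt (Phi (- z)).
  by rewrite divr_ge0// sqrtr_ge0.
by rewrite lef_pV2 ?posrE ?ltr_wpDr// lerDl.
Qed.

(** On the window the p-value is at most q^(-2), so the integrand is at most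
    1 / (k + b q) there and 1 / k elsewhere.  The difference of these two is at
    least b q / 2, and the window has mass at least [phi r]. *)
Lemma integral_inv_lr_low_signal_le b k q m r t0 :
  0 < b -> 0 < k <= 1 -> 0 < q -> b * q <= 1 ->
  (forall z, t0 <= z <= t0 + 1 -> Phi (- z) <= q ^- 2 /\ `|z - m| <= r) ->
  (\int[mu]_z (inv_lr_low b k z * normal_pdf m 1 z)%:E <=
    (k^-1 - b * q / 2 * phi r)%:E)%E.
Proof.
move=> b0 /andP[k0 k1] q0 bq hD.
have mpdf : @measurable_fun _ _ (measurableTypeR R) R setT (normal_pdf m 1).
  exact: measurable_normal_pdf.
have mg : @measurable_fun _ _ (measurableTypeR R) R setT (inv_lr_low b k).
  exact: measurable_inv_lr_low.
have g0 z : 0 <= inv_lr_low b k z by apply: inv_lr_low_ge0; exact: ltW.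
have pdf0 z : 0 <= normal_pdf m 1 z by exact: normal_pdf_ge0.
pose D : set R := `[t0, t0 + 1]%classic.
have mD : @measurable _ (measurableTypeR R) D by exact: measurable_itv.
pose c := b * q / 2.
have c0 : 0 <= c by rewrite divr_ge0// mulr_ge0 ?ltW.
rewrite EFinB leeBrDr//.
apply: (@le_trans _ _ (\int[mu]_z (inv_lr_low b k z * normal_pdf m 1 z)%:E +
    \int[mu]_z (c * \1_D z * normal_pdf m 1 z)%:E)%E).
  rewrite leeD2l//.
  have -> : (\int[mu]_z (c * \1_D z * normal_pdf m 1 z)%:E =
      c%:E * \int[mu]_(z in D) (normal_pdf m 1 z)%:E)%E.
    rewrite [X in (_ * X)%E]integral_mkcond -ge0_integralZl//=; last 2 first.
    - apply/(measurable_restrictT _ mD)/measurable_EFinP/measurable_funTS.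
      exact: mpdf.
    - by move=> z _; rewrite patchE; case: ifP => // _; rewrite lee_fin.
    apply: eq_integral => z _; rewrite patchE indicE.
    by case: ifPn => _ /=; rewrite ?mulr1 ?mulr0 ?mul0r ?mule0.
  rewrite EFinM lee_wpmul2l ?lee_fin//.
  have := @normal_prob_itv_ge R m t0 (t0 + 1) r.
  rewrite addrAC subrr add0r mulr1; apply; first by rewrite lerDl.
  by move=> t /hD[].
rewrite -ge0_integralD//=; last 4 first.
- by move=> z _; rewrite lee_fin mulr_ge0.
- by apply/measurable_EFinP; exact: measurable_funM.
- by move=> z _; rewrite lee_fin mulr_ge0// mulr_ge0.
- apply/measurable_EFinP; apply: measurable_funM => //.
  by apply: measurable_funM => //; exact: measurable_indic.
apply: (@le_trans _ _ (\int[mu]_z ((k^-1)%:E * (normal_pdf m 1 z)%:E))%E).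
  apply: ge0_le_integral => //=.
  - move=> z _; rewrite -EFinD lee_fin addr_ge0//; apply: mulr_ge0 => //.
    exact: mulr_ge0.
  - apply/measurable_EFinP; apply: measurable_funD.
      exact: measurable_funM.
    apply: measurable_funM => //.
    by apply: measurable_funM => //; exact: measurable_indic.
  - by apply/measurable_EFinP; exact: measurable_funM.
  move=> z _; rewrite -EFinM -EFinD lee_fin -mulrDl ler_wpM2r//.
  rewrite indicE; have [|_] := boolP (z \in D); last first.
    by rewrite mulr0 addr0 inv_lr_low_le// ltW.
  rewrite inE /D/= in_itv/= mulr1 => /hD[pq _].
  have p0 := Phi_gt0 (- z).
  have s0 : 0 < Num.sqrt (Phi (- z)) by rewrite sqrtr_gt0.
  have sq : q <= (Num.sqrt (Phi (- z)))^-1.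
    rewrite -[q]invrK lef_pV2 ?posrE ?invr_gt0//.
    rewrite -(ger0_norm (ltW q0)) -normfV -sqrtr_sqr exprVn.
    by rewrite ler_sqrt// invr_ge0 sqr_ge0.
  have bqs : b * q <= b / Num.sqrt (Phi (- z)) by rewrite ler_wpM2l// ltW.
  have bq0 : 0 < b * q by rewrite mulr_gt0.
  apply: (@le_trans _ _ ((k + b * q)^-1 + c)).
    by rewrite lerD2r lef_pV2 ?posrE; lra.
  have -> : (k + b * q)^-1 = k^-1 - b * q / (k * (k + b * q)).
    by field; rewrite !gt_eqF// addr_gt0.
  rewrite -addrA gerDl addrC subr_le0 /c ler_wpM2l ?(ltW bq0)//.
  rewrite lef_pV2 ?posrE ?mulr_gt0 ?addr_gt0//; nra.
rewrite ge0_integralZl//; last 3 first.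
- exact/measurable_EFinP.
- by move=> z _; rewrite lee_fin.
- by rewrite lee_fin invr_ge0 ltW.
by rewrite integral_normal_pdf mule1.
Qed.

(** * Sampling from the normal mixture *)

Definition mixture_pdf eps m (z : R) : R :=
  (1 - eps) * phi z + eps * normal_pdf m 1 z.

Lemma measurable_mixture_pdf eps m : measurable_fun setT (mixture_pdf eps m).
Proof.
by apply: measurable_funD; apply: measurable_funM => //;
  exact: measurable_normal_pdf.
Qed.

Lemma mixture_pdf_ge0 eps m z : 0 <= eps <= 1 -> 0 <= mixture_pdf eps m z.
Proof.
move=> /andP[e0 e1].
by rewrite addr_ge0// mulr_ge0 ?normal_pdf_ge0// subr_ge0.
Qed.

Lemma ge0_integral_mixture_pdf eps m (g : R -> R) (D : set R) :
  @measurable _ (measurableTypeR R) D ->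
  0 <= eps <= 1 -> measurable_fun setT g -> (forall z, 0 <= g z) ->
  (\int[mu]_(z in D) (g z * mixture_pdf eps m z)%:E =
   (1 - eps)%:E * \int[mu]_(z in D) (g z * phi z)%:E +
   eps%:E * \int[mu]_(z in D) (g z * normal_pdf m 1 z)%:E)%E.
Proof.
move=> mD /andP[e0 e1] mg g0.
have e1' : 0 <= 1 - eps by rewrite subr_ge0.
have mgp m' : @measurable_fun _ _ (measurableTypeR R) _ D
    (fun z => (g z * normal_pdf m' 1 z)%:E).
  apply/measurable_EFinP/measurable_funTS/measurable_funM => //.
  exact: measurable_normal_pdf.
have gp0 m' z : (0 <= (g z * normal_pdf m' 1 z)%:E)%E.
  by rewrite lee_fin mulr_ge0// normal_pdf_ge0.
rewrite -!ge0_integralZl// -?ge0_integralD//=; last 4 first.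
- by move=> z _; rewrite mule_ge0.
- by apply: measurable_funeM; exact: mgp.
- by move=> z _; rewrite mule_ge0.
- by apply: measurable_funeM; exact: mgp.
apply: eq_integral => z _; rewrite -!EFinM -EFinD /mixture_pdf.
by congr EFin; ring.
Qed.

(** The mixture law is only a set function; having a density makes it usable
    in integrals. *)
Lemma normal_mixture_lawE eps m (A : set R) : measurable A -> 0 <= eps <= 1 ->
  (normal_mixture_law eps m A = \int[mu]_(z in A) (mixture_pdf eps m z)%:E)%E.
Proof.
move=> mA e01.
have := @ge0_integral_mixture_pdf eps m (cst 1) A mA e01.
rewrite /= => /(_ (measurable_cst _) (fun=> ler01)).
have E f : (\int[mu]_(z in A) (1 * f z)%:E = \int[mu]_(z in A) (f z)%:E)%E.
  by apply: eq_integral => z _; rewrite mul1r.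
by rewrite !E.
Qed.

Lemma expectation_mixture (d : measure_display) (T : measurableType d)
    (P : probability T R) (X : {mfun T >-> R}) eps m (g : R -> R) :
  0 <= eps <= 1 ->
  (forall A : set R, measurable A ->
    distribution P X A = normal_mixture_law eps m A) ->
  measurable_fun setT g -> (forall z, 0 <= g z) ->
  (\int[P]_w (g (X w))%:E =
   (1 - eps)%:E * \int[mu]_z (g z * phi z)%:E +
   eps%:E * \int[mu]_z (g z * normal_pdf m 1 z)%:E)%E.
Proof.
move=> e01 law mg g0.
rewrite (@ge0_integral_law_density R d T P X (mixture_pdf eps m))//.
- exact: ge0_integral_mixture_pdf.
- exact: measurable_mixture_pdf.
- by move=> z; exact: mixture_pdf_ge0.
- by move=> A mA; rewrite law// normal_mixture_lawE.
Qed.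

(** * Error bounds for a fixed sample size *)

Lemma expectation_lr_le1 (d : measure_display) (T : measurableType d)
    (P : probability T R) (X : {mfun T >-> R}) a b :
  (forall A : set R, measurable A -> distribution P X A = normal_prob 0 1 A) ->
  0 <= a -> 0 <= b -> 2 * b + a / 2 <= 1 ->
  (\int[P]_w (lr a b (Phi (- X w)))%:E <= 1)%E.
Proof.
move=> law a0 b0 ab.
rewrite (@ge0_integral_law_density R d T P X phi
  (fun z => lr a b (Phi (- z))))//.
- exact: integral_lr_le1.
- exact: measurable_normal_pdf.
- by move=> z; exact: normal_pdf_ge0.
- apply: (measurableT_comp (measurable_lr a b)); exact: measurable_PhiN.
- move=> z; apply: le_trans (lr_ge b a0 (ltW (Phi_gt0 _))).
  have : 0 <= b / Num.sqrt (Phi (- z)) by rewrite divr_ge0// sqrtr_ge0.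
  lra.
Qed.

Lemma measurable_score (d : measure_display) (T : measurableType d)
    (l1 l2 : R) (N : nat) (Z : 'I_N -> {mfun T >-> R}) :
  measurable_fun setT (fun w => score l1 l2 (pvalue (Z ^~ w))).
Proof.
apply: measurable_sum => i.
apply: (measurableT_comp (f := fun z : R => score1 l1 l2 N (Phi (- z)))) => //.
apply: (measurableT_comp (@measurable_ln R)).
apply: (measurableT_comp (measurable_lr _ _)).
exact: measurable_PhiN.
Qed.

Lemma expR_score (l1 l2 : R) (N : nat) (p : 'I_N -> R) :
  let a := l1 * ln N%:R / N%:R in let b := l2 / Num.sqrt (N%:R * ln N%:R) in
  (forall i, 0 < lr a b (p i)) ->
  expR (score l1 l2 p) = \prod_i lr a b (p i).
Proof.
move=> a b lr0; rewrite expR_sum; apply: eq_bigr => i _.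
by rewrite /score1 lnK// posrE lr0.
Qed.

(** The product of the factors has mean at most 1 under the null. *)
Lemma size_le (d : measure_display) (T : measurableType d)
    (P : probability T R) (N : nat) (Z : 'I_N -> {mfun T >-> R}) (l1 l2 c : R) :
  let a := l1 * ln N%:R / N%:R in let b := l2 / Num.sqrt (N%:R * ln N%:R) in
  iid P Z (normal_prob 0 1) -> 0 <= a -> 0 < b -> 2 * b + a / 2 <= 1 ->
  (P [set w | (c <= score l1 l2 (pvalue (Z ^~ w)))%R] <= (expR (- c))%:E)%E.
Proof.
move=> a b [indep law] a0 b0 ab.
have lr0 z : 0 < lr a b (Phi (- z)).
  apply: lt_le_trans (lr_ge b a0 (ltW (Phi_gt0 _))).
  have : 0 < b / Num.sqrt (Phi (- z)) by rewrite divr_gt0// sqrtr_gt0 Phi_gt0.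
  lra.
rewrite expRN -[X in (_ <= X%:E)%E]mul1r -[X in (X / _)](expr1n _ #|'I_N|).
apply: (prob_le_prod_independent indep (g := fun z => lr a b (Phi (- z)))).
- apply: (measurableT_comp (measurable_lr a b)); exact: measurable_PhiN.
- by move=> z; rewrite ltW.
- move=> i; apply: expectation_lr_le1 => //; [exact: law|exact: ltW].
- exact: expR_gt0.
- have /(_ measurableT [set true] I) :=
    measurable_fun_ler (measurable_cst c) (measurable_score l1 l2 Z).
  by rewrite setTI preimage_true.
- by move=> w /= cs; rewrite -(@expR_score l1 l2 N) ?ler_expR.
Qed.

(** Chernoff's bound for the opposite of the score, with
    (1 + x)^N <= exp (N x).  In the exponent, 2 a + 8 b^2 - 16 b^2 ln b bounds
    what null observations add to E 1/X - 1, eps (4 b + a) bounds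
    eps (1/k - 1), and the subtracted term is the gain from the signals. *)
Lemma power_le (d : measure_display) (T : measurableType d)
    (P : probability T R) (N : nat) (Z : 'I_N -> {mfun T >-> R})
    (l1 l2 c eps m q r t0 : R) :
  let a := l1 * ln N%:R / N%:R in let b := l2 / Num.sqrt (N%:R * ln N%:R) in
  iid P Z (normal_mixture_law eps m) -> 0 <= eps <= 1 ->
  0 <= a -> 0 < b -> 4 * b + a <= 1 ->
  0 < q -> b * q <= 1 ->
  (forall z, t0 <= z <= t0 + 1 -> Phi (- z) <= q ^- 2 /\ `|z - m| <= r) ->
  (P [set w | (score l1 l2 (pvalue (Z ^~ w)) < c)%R] <=
   (expR (c + N%:R * (2 * a + 8 * b ^+ 2 - 16 * b ^+ 2 * ln b
       + eps * (4 * b + a) - eps * (b * q / 2 * phi r))))%:E)%E.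
Proof.
move=> a b [indep law] e01 a0 b0 ab q0 bq Dz.
pose k := 1 - 2 * b - a / 2.
have k2 : 2^-1 <= k by rewrite /k; lra.
have k1 : k <= 1 by rewrite /k; lra.
have k0 : 0 < k by lra.
have bs z : 0 < b / Num.sqrt (Phi (- z)).
  by rewrite divr_gt0// sqrtr_gt0 Phi_gt0.
have lr0 z : k + b / Num.sqrt (Phi (- z)) <= lr a b (Phi (- z)).
  by apply: lr_ge => //; exact/ltW/Phi_gt0.
have lrp z : 0 < lr a b (Phi (- z)).
  by apply: lt_le_trans (lr0 z); rewrite addr_gt0.
set s := _ + _ - eps * _.
have g0 z : 0 <= inv_lr_low b k z by apply: inv_lr_low_ge0; exact: ltW.
have Eg i : (\int[P]_w (inv_lr_low b k (Z i w))%:E <= (1 + s)%:E)%E.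
  rewrite (expectation_mixture e01 (law i))//; last first.
    exact: measurable_inv_lr_low.
  have /andP[e0 e1] := e01.
  have I0 : (\int[mu]_z (inv_lr_low b k z * phi z)%:E <=
      (1 + 2 * a + 8 * b ^+ 2 - 16 * b ^+ 2 * ln b)%:E)%E.
    apply: le_trans (integral_lr_low_inv_le b0 _ _ _) _.
    - by rewrite k2 k1.
    - by rewrite /k; lra.
    - by rewrite /k; lra.
    rewrite lee_fin lerD2r lerD2r ler_pdivrMr ?exprn_gt0//.
    rewrite {1}/k; have : 1 / 4 <= k ^+ 2 by nra.
    (* (k - 2 b) / k^2 has no first-order term in b: its numerator
       1 - 4 b - a / 2 is at most k^2 + a / 2. *)
    have : 1 - 4 * b - a <= k ^+ 2.
      have -> : k ^+ 2 = 1 - 4 * b - a + (2 * b + a / 2) ^+ 2.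
        by rewrite /k; field.
      by rewrite lerDl sqr_ge0.
    nra.
  have I1 := integral_inv_lr_low_signal_le b0 (_ : 0 < k <= 1) q0 bq Dz.
  have {}I1 := I1 (introT andP (conj k0 k1)).
  have kV : k^-1 <= 1 + 4 * b + a.
    rewrite -[k^-1]mul1r ler_pdivrMr// /k; nra.
  apply: (@le_trans _ _ ((1 - eps)%:E *
        (1 + 2 * a + 8 * b ^+ 2 - 16 * b ^+ 2 * ln b)%:E +
      eps%:E * (k^-1 - b * q / 2 * phi r)%:E)%E).
    by rewrite leeD// lee_wpmul2l// lee_fin// subr_ge0.
  rewrite -!EFinM -EFinD lee_fin /s.
  have lb0 : ln b <= 0 by rewrite ln_le0//; lra.
  have b2 : 0 <= - (b ^+ 2 * ln b).
    by rewrite -mulrN mulr_ge0 ?sqr_ge0 ?oppr_ge0.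
  have b3 := sqr_ge0 b.
  have ek : eps * k^-1 <= eps * (1 + 4 * b + a) by rewrite ler_wpM2l.
  set Q := b * q / 2 * phi r.
  have : (1 - eps) * (2 * a + 8 * b ^+ 2 - 16 * b ^+ 2 * ln b) <=
      2 * a + 8 * b ^+ 2 - 16 * b ^+ 2 * ln b.
    rewrite ler_piMl//; lra.
  lra.
have Pi : forall w, score l1 l2 (pvalue (Z ^~ w)) < c ->
    expR (- c) <= \prod_i inv_lr_low b k (Z i w).
  move=> w sc; apply: (@le_trans _ _ (\prod_i (lr a b (Phi (- Z i w)))^-1)).
    by rewrite prodfV -(@expR_score l1 l2 N) -?expRN ?ler_expR ?lerN2 ?ltW.
  apply: ler_prod => i _; rewrite invr_ge0 (ltW (lrp _))/=.
  by rewrite lef_pV2 ?posrE ?lrp// addr_gt0.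
have := prob_le_prod_independent indep (measurable_inv_lr_low b k) g0 Eg
  (expR_gt0 (- c)).
move=> /(_ [set w | (score l1 l2 (pvalue (Z ^~ w)) < c)%R]) /(_ _ Pi) PE.
apply: le_trans (PE _) _.
  have /(_ measurableT [set true] I) :=
    measurable_fun_ltr (measurable_score l1 l2 Z) (measurable_cst c).
  by rewrite setTI preimage_true.
rewrite lee_fin expRN invrK expRD mulrC ler_wpM2l ?expR_ge0//.
rewrite card_ord expRM_natl.
have [N0|N0] := posnP N; first by rewrite [X in _ ^+ X]N0 [X in _ <= _ ^+ X]N0.
have s1 : 0 <= 1 + s.
  rewrite -lee_fin; apply: le_trans (Eg (Ordinal N0)).
  by apply: integral_ge0 => w _; rewrite lee_fin.
by rewrite lerXn2r ?nnegrE ?expR_ge0// expR_ge1Dx.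
Qed.

End tests.

(** * Growth rates at the detection boundary *)

Section asymptotics.
Context (R : realType).
Local Notation phi := (normal_pdf (0 : R) 1).

(** The exponent (1 + s) / 2 - beta - max (sqrt s - sqrt nu, 0)^2 is maximal
    over 0 < s <= 1 at s = min (4 nu, 1).  If 4 nu <= 1 its value is
    1 / 2 + nu - beta, and rho_Z(beta) is never below beta - 1 / 2.  Otherwise
    s = 1 and sqrt nu > 1 / 2: for beta < 3 / 4 the exponent is positive since
    1 - beta > 1 / 4, and for beta >= 3 / 4 its positivity is the inequality
    1 - sqrt nu < sqrt (1 - beta), which follows from
    nu > (1 - sqrt (1 - beta))^2. *)
Lemma detection_exponent (beta nu : R) :
  1 / 2 < beta -> beta < 1 -> rhoZ beta < nu ->
  exists s r, [/\ 0 < s <= 1, 0 <= r, Num.sqrt s <= Num.sqrt nu + r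
    & 0 < (1 + s) / 2 - beta - r ^+ 2].
Proof.
move=> b0 b1 hnu.
pose t := Num.sqrt (1 - beta).
have t0 : 0 < t by rewrite sqrtr_gt0; lra.
have t2 : t ^+ 2 = 1 - beta by rewrite sqr_sqrtr//; lra.
have nub : beta - 1 / 2 < nu.
  apply: le_lt_trans hnu; rewrite /rhoZ -/t; case: ifP => // _.
  have := sqr_ge0 (t - 1 / 2); nra.
have nu0 : 0 < nu by lra.
pose x := Num.sqrt nu.
have x0 : 0 < x by rewrite sqrtr_gt0.
have x2 : x ^+ 2 = nu by rewrite sqr_sqrtr//; lra.
rewrite -/x; have [nu4|nu4] := leP (4 * nu) 1.
  exists (4 * nu), x; split; [lra|exact: ltW| |lra].
  have -> : 4 * nu = (2 * x) ^+ 2 by rewrite exprMn x2; ring.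
  by rewrite sqrtr_sqr ger0_norm; lra.
have x12 : 1 / 2 < x by nra.
have [x1|x1] := leP 1 x.
  by exists 1, 0; rewrite sqrtr1; split; lra.
exists 1, (1 - x); rewrite sqrtr1; split; [lra|lra|lra|].
have xt : 1 - x < t.
  move: hnu; rewrite /rhoZ -/t; have [b34|b34] := ltP beta (3 / 4) => hnu.
    have t12 : 1 / 2 < t.
      by rewrite -(ltr_pXn2r (n := 2)) ?nnegrE//; lra.
    lra.
  have t12 : t <= 1 / 2.
    by rewrite -(ler_pXn2r (n := 2)) ?nnegrE//; lra.
  suff : 1 - t < x by lra.
  rewrite -(ltr_pXn2r (n := 2)) ?nnegrE ?x2 ?ltW//; lra.
nra.
Qed.

(** Here N = exp (v^2), so N a = l1 log N and N b^2 = l2^2 / log N.  The latter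
    balances - ln b, which is of order log N, and beta > 1 / 2 makes
    N eps b bounded. *)
Lemma drift_le (l1 l2 beta v : R) :
  let x := expR (v ^+ 2) in
  let a := l1 * v ^+ 2 / x in
  let b := l2 / (expR (v ^+ 2 / 2) * v) in
  let eps := expR (- (beta * v ^+ 2)) in
  0 <= l1 -> 0 < l2 -> 1 / 2 < beta -> 1 <= v ->
  x * (2 * a + 8 * b ^+ 2 - 16 * b ^+ 2 * ln b + eps * (4 * b + a)) <=
  3 * l1 * v ^+ 2 + (24 * l2 ^+ 2 + 16 * l2 ^+ 2 * `|ln l2| + 4 * l2).
Proof.
move=> x a b eps l10 l20 beta12 v1.
have v0 : 0 < v by lra.
pose h := expR (v ^+ 2 / 2).
have h0 : 0 < h by exact: expR_gt0.
have xh : x = h * h by rewrite /x /h -expRD; congr expR; field.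
have h1 : 1 <= h by rewrite -expR0 ler_expR divr_ge0// sqr_ge0.
have v2 : 1 <= v ^+ 2 by nra.
have eps1 : eps * h <= 1.
  rewrite /eps /h -expRD -[leRHS]expR0 ler_expR; nra.
have eps0 : 0 < eps by exact: expR_gt0.
have xa : x * a = l1 * v ^+ 2 by rewrite /a; field; rewrite gt_eqF// expR_gt0.
have hbv : h * b * v = l2 by rewrite /b -/h; field; rewrite !gt_eqF.
have b0 : 0 < b by rewrite divr_gt0// mulr_gt0.
have hb : h * b <= l2 by rewrite -hbv ler_peMr// mulr_ge0// ltW.
have xb : x * b ^+ 2 * v ^+ 2 = l2 ^+ 2 by rewrite xh -hbv; ring.
have lnb : - ln b <= `|ln l2| + v ^+ 2.
  rewrite /b lnM ?posrE ?invr_gt0 ?mulr_gt0// lnV ?posrE ?mulr_gt0//.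
  rewrite lnM ?posrE// expRK.
  have := ler_norm (- ln l2); rewrite normrN.
  have lv : ln v <= v - 1 by rewrite -{1}(subrKC 1 v) le_ln1Dx//; lra.
  have := sqr_ge0 (v - 1); nra.
have xb0 : 0 <= x * b ^+ 2 by rewrite mulr_ge0 ?sqr_ge0// ltW// expR_gt0.
have xb1 : x * b ^+ 2 <= l2 ^+ 2 by rewrite -xb ler_peMr.
have e1 : x * b ^+ 2 * - ln b <= l2 ^+ 2 * `|ln l2| + l2 ^+ 2.
  apply: (@le_trans _ _ (x * b ^+ 2 * (`|ln l2| + v ^+ 2))).
    by rewrite ler_wpM2l.
  by rewrite mulrDr xb lerD2r ler_wpM2r.
have a0 : 0 <= a by rewrite divr_ge0 ?expR_ge0// mulr_ge0// sqr_ge0.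
have e2 : x * (eps * b) <= l2.
  have -> : x * (eps * b) = eps * h * (h * b) by rewrite xh; ring.
  apply: le_trans hb; rewrite ler_piMl// mulr_ge0// ltW//.
have e3 : x * (eps * a) <= l1 * v ^+ 2.
  have lv0 : 0 <= l1 * v ^+ 2 by rewrite mulr_ge0// sqr_ge0.
  rewrite mulrCA xa ler_piMl//.
  by apply: le_trans eps1; rewrite ler_peMr// ltW//.
nra.
Qed.

(** The exact size of the gain is a constant times
    exp (eta v^2 - r sqrt 2 v) / v; the hypothesis says that half of the
    quadratic exponent absorbs the other factors. *)
Lemma gain_ge (l2 beta s r v : R) :
  let x := expR (v ^+ 2) in
  let b := l2 / (expR (v ^+ 2 / 2) * v) in
  let eps := expR (- (beta * v ^+ 2)) in
  let q := expR (s * v ^+ 2 / 2) in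
  let eta := (1 + s) / 2 - beta - r ^+ 2 in
  0 < l2 -> 0 < v ->
  (r * Num.sqrt 2 + 1) * v + 1 / 2 - ln (l2 * normal_peak 1 / 2) <=
    eta * v ^+ 2 / 2 ->
  expR (eta * v ^+ 2 / 2) <=
    x * (eps * (b * q / 2 * phi (r * Num.sqrt 2 * v + 1))).
Proof.
move=> x b eps q eta l20 v0 hv.
have pk0 : 0 < normal_peak (1 : R) by rewrite normal_peak_gt0 ?oner_eq0.
set K := ln _ in hv.
have KE : l2 * normal_peak 1 / 2 = expR K.
  by rewrite lnK// posrE divr_gt0// mulr_gt0.
have vV : expR (- v) <= v^-1.
  rewrite expRN lef_pV2 ?posrE ?expR_gt0//.
  by apply: le_trans (expR_ge1Dx v); rewrite lerDr.
set y := r * Num.sqrt 2 * v + 1.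
have y2 : y ^+ 2 / 2 = r ^+ 2 * v ^+ 2 + r * Num.sqrt 2 * v + 1 / 2.
  have s2 : Num.sqrt 2 ^+ 2 = 2 :> R by rewrite sqr_sqrtr.
  have -> : y ^+ 2 / 2 =
      r ^+ 2 * v ^+ 2 * (Num.sqrt 2 ^+ 2) / 2 + r * Num.sqrt 2 * v + 1 / 2.
    by rewrite /y; field.
  by rewrite s2; field.
have -> : x * (eps * (b * q / 2 * phi y)) =
    expR K * (expR (eta * v ^+ 2 - r * Num.sqrt 2 * v - 1 / 2) * v^-1).
  have -> : expR (eta * v ^+ 2 - r * Num.sqrt 2 * v - 1 / 2) =
      x * eps * q * (expR (v ^+ 2 / 2))^-1 * expR (- (y ^+ 2 / 2)).
    by rewrite /x /eps /q -expRN -!expRD y2; congr expR; rewrite /eta; field.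
  rewrite -KE normal_pdfE ?oner_eq0//= /normal_fun subr0 expr1n.
  rewrite (_ : - y ^+ 2 / 2%:R = - (y ^+ 2 / 2)); last by rewrite mulNr.
  rewrite /b; field.
  by rewrite !gt_eqF// expR_gt0.
apply: (@le_trans _ _ (expR K *
    (expR (eta * v ^+ 2 - r * Num.sqrt 2 * v - 1 / 2) * expR (- v)))).
  rewrite -!expRD ler_expR; lra.
by rewrite ler_wpM2l ?expR_ge0// ler_wpM2l ?expR_ge0.
Qed.

End asymptotics.

Section large_N.
Context (R : realType).

Lemma near_le_ln (K : R) : \forall N \near \oo, K <= ln (N%:R : R).
Proof.
near=> N; rewrite -[K]expRK ler_ln ?posrE ?expR_gt0//.
- by near: N; exact: nbhs_infty_ger.
- by rewrite ltr0n; near: N; exists 1%N.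
Unshelve. all: by end_near. Qed.

Lemma near_le_sqrt_ln (K : R) :
  \forall N \near \oo, K <= Num.sqrt (ln (N%:R : R)).
Proof.
near=> N; apply: (le_trans (ler_norm K)).
by rewrite -sqrtr_sqr ler_wsqrtr//; near: N; exact: near_le_ln.
Unshelve. all: by end_near. Qed.

Lemma cvg_expRN_ge (u : nat -> R) :
  (forall K, \forall N \near \oo, K <= u N) ->
  expR (- u N) @[N --> \oo] --> 0.
Proof.
move=> uoo.
apply: (cvg_comp u (fun x : R => expR (- x)) _ (@cvgr_expR R)).
exact/cvgryPge.
Qed.

(** With v = sqrt (log N), the weights in the forms used by the growth
    estimates, and their smallness for large v. *)
Lemma score_weights (l1 l2 : R) (N : nat) :
  let v := Num.sqrt (ln (N%:R : R)) in
  let a := l1 * ln N%:R / N%:R in let b := l2 / Num.sqrt (N%:R * ln N%:R) in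
  0 <= l1 -> 0 < l2 -> 1 <= v -> 8 * l2 <= v -> 4 * l1 <= v ^+ 2 ->
  [/\ N%:R = expR (v ^+ 2), a = l1 * v ^+ 2 / expR (v ^+ 2),
      b = l2 / (expR (v ^+ 2 / 2) * v)
    & [/\ 0 <= a, 0 < b, 4 * b + a <= 1 & expR (v ^+ 2 / 2) * b <= 1]].
Proof.
move=> v a b l10 l20 v1 vl2 vl1.
have v0 : 0 < v by lra.
have L0 : 0 < ln (N%:R : R) by rewrite -sqrtr_gt0.
have Lv : ln (N%:R : R) = v ^+ 2 by rewrite sqr_sqrtr// ltW.
have N0 : 0 < (N%:R : R).
  by rewrite ltNge; apply/negP => N0; move: L0; rewrite ln0// ltxx.
have Nx : N%:R = expR (v ^+ 2) by rewrite -Lv lnK.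
have hx : expR (v ^+ 2) = expR (v ^+ 2 / 2) ^+ 2.
  by rewrite [RHS]expr2 -expRD; congr expR; field.
have sNL : Num.sqrt (N%:R * ln (N%:R : R)) = expR (v ^+ 2 / 2) * v.
  rewrite Lv Nx hx -exprMn sqrtr_sqr ger0_norm// mulr_ge0 ?expR_ge0//.
  exact: ltW.
have aE : a = l1 * v ^+ 2 / expR (v ^+ 2) by rewrite /a Lv Nx.
have bE : b = l2 / (expR (v ^+ 2 / 2) * v) by rewrite /b sNL.
have h1 : 1 <= expR (v ^+ 2 / 2) by rewrite -expR0 ler_expR divr_ge0// sqr_ge0.
have b0 : 0 < b by rewrite bE divr_gt0// mulr_gt0// expR_gt0.
have hb : expR (v ^+ 2 / 2) * b <= 1 / 8.
  have -> : expR (v ^+ 2 / 2) * b = l2 / v.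
    by rewrite bE; field; rewrite !gt_eqF// expR_gt0.
  rewrite ler_pdivrMr//; lra.
have b8 : b <= 1 / 8.
  by apply: le_trans hb; rewrite ler_peMl// ltW.
have a0 : 0 <= a by rewrite aE divr_ge0 ?expR_ge0// mulr_ge0// sqr_ge0.
have a2 : a <= 1 / 2.
  rewrite aE ler_pdivrMr ?expR_gt0//.
  have := @expR_ge1Dxn _ (v ^+ 2) 1 (sqr_ge0 v).
  rewrite (_ : 2`!%:R = 2)//; have := sqr_ge0 v; nra.
by split => //; split => //; lra.
Qed.

(** Drift plus level is at most w + (12 l1 / eta) w + C0, with C0 the last
    summand in the lower bound on [w], since log N is at most 4 w / eta, while
    the gain is at least w^2.  That lower bound makes the difference at most
    - w. *)
Lemma power_at_boundary (d : measure_display) (T : measurableType d)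
    (P : probability T R) (N : nat) (Z : 'I_N -> {mfun T >-> R})
    (l1 l2 beta nu s r c : R) :
  let v := Num.sqrt (ln (N%:R : R)) in
  let eta := (1 + s) / 2 - beta - r ^+ 2 in
  let w := expR (eta * v ^+ 2 / 4) in
  iid P Z (normal_mixture_law (N%:R `^ (- beta))
    (Num.sqrt (2 * nu * ln N%:R))) ->
  0 <= l1 -> 0 < l2 -> 1 / 2 < beta -> 0 < s <= 1 -> 0 <= r -> 0 <= nu ->
  Num.sqrt s <= Num.sqrt nu + r -> 0 < eta ->
  1 <= v -> 8 * l2 <= v -> 4 * l1 <= v ^+ 2 ->
  (r * Num.sqrt 2 + 1) * v + 1 / 2 - ln (l2 * normal_peak 1 / 2) <=
    eta * v ^+ 2 / 2 ->
  2 + 12 * l1 / eta + (24 * l2 ^+ 2 + 16 * l2 ^+ 2 * `|ln l2| + 4 * l2) <= w ->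
  c <= w ->
  (P [set w | (score l1 l2 (pvalue (Z ^~ w)) < c)%R] <= (expR (- w))%:E)%E.
Proof.
move=> v eta w hP l10 l20 beta12 /andP[s0 s1] r0 nu0 snu eta0.
move=> v1 vl2 vl1 hgain hw cw.
have v0 : 0 < v by lra.
pose a := l1 * ln N%:R / N%:R.
pose b := l2 / Num.sqrt (N%:R * ln N%:R).
have := score_weights l10 l20 v1 vl2 vl1.
rewrite -/v -/a -/b => -[Nx aE bE [a0 b0 ab hb]].
have Lv : ln (N%:R : R) = v ^+ 2 by rewrite Nx expRK.
have epsE : N%:R `^ (- beta) = expR (- (beta * v ^+ 2)).
  by rewrite Nx -expRM mulrN mulrC.
rewrite epsE in hP.
pose q := expR (s * v ^+ 2 / 2).
(* The window of observations starts at mean + y, which is at least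
   sqrt (2 s log N). *)
pose y := r * Num.sqrt 2 * v.
pose m := Num.sqrt (2 * nu * ln (N%:R : R)).
have q0 : 0 < q by exact: expR_gt0.
have bq : b * q <= 1.
  apply: (@le_trans _ _ (expR (v ^+ 2 / 2) * b)); last exact: hb.
  rewrite mulrC ler_wpM2r// ?(ltW b0)// ler_expR ler_pM2r ?invr_gt0//.
  by rewrite ler_piMl// sqr_ge0.
have y0 : 0 <= y by rewrite !mulr_ge0 ?sqrtr_ge0// ltW.
have Dz z : m + y <= z <= m + y + 1 ->
    Phi (- z) <= q ^- 2 /\ `|z - m| <= y + 1.
  move=> /andP[z0 z1]; split; last by rewrite ger0_norm; lra.
  have mE : m = Num.sqrt 2 * Num.sqrt nu * v.
    by rewrite /m sqrtrM ?mulr_ge0// sqrtrM.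
  have s2 : Num.sqrt 2 ^+ 2 = 2 :> R by rewrite sqr_sqrtr.
  have zs : Num.sqrt 2 * Num.sqrt s * v <= z.
    apply: le_trans z0.
    have -> : m + y = Num.sqrt 2 * (Num.sqrt nu + r) * v.
      by rewrite mE /y; ring.
    by rewrite ler_wpM2r ?(ltW v0)// ler_wpM2l ?sqrtr_ge0.
  have zs0 : 0 <= Num.sqrt 2 * Num.sqrt s * v.
    by rewrite !mulr_ge0 ?sqrtr_ge0// ltW.
  apply: le_trans (PhiN_le (le_trans zs0 zs)) _.
  rewrite /q -expRM_natl -expRN ler_expR lerN2.
  have : (Num.sqrt 2 * Num.sqrt s * v) ^+ 2 <= z ^+ 2.
    by rewrite lerXn2r ?nnegrE// (le_trans zs0).
  rewrite !exprMn s2 sqr_sqrtr ?(ltW s0)//.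
  lra.
have e01 : 0 <= expR (- (beta * v ^+ 2)) <= 1.
  rewrite expR_ge0 -expR0 ler_expR oppr_le0 mulr_ge0// ?sqr_ge0//; lra.
have := @power_le R d T P N Z l1 l2 c _ m q (y + 1) (m + y) hP.
move=> /(_ e01 a0 b0 ab q0 bq Dz) /le_trans; apply.
rewrite lee_fin ler_expR.
have drift := drift_le l10 l20 beta12 v1.
have gain := gain_ge l20 v0 hgain.
rewrite -aE -bE -Nx in drift gain.
rewrite -/q -/eta -/y in gain.
have w2 : expR (eta * v ^+ 2 / 2) = w ^+ 2.
  by rewrite /w [RHS]expr2 -expRD; congr expR; field.
rewrite w2 in gain.
have Lw : v ^+ 2 <= 4 / eta * w.
  have : eta * v ^+ 2 / 4 <= w.
    by apply: le_trans (expR_ge1Dx _); rewrite lerDr.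
  move=> H; rewrite mulrAC ler_pdivlMr//; lra.
have Lw' : 3 * l1 * v ^+ 2 <= 12 * l1 / eta * w.
  have -> : 12 * l1 / eta * w = 3 * l1 * (4 / eta * w) by ring.
  by rewrite ler_wpM2l// mulr_ge0.
set C0 := _ + 4 * l2 in hw drift.
have C00 : 0 <= C0.
  by rewrite !addr_ge0 ?mulr_ge0 ?sqr_ge0// ltW.
have l1eta : 0 <= 12 * l1 / eta by rewrite divr_ge0 ?mulr_ge0// ltW.
set C1 := 12 * l1 / eta in hw Lw' l1eta.
set D := 2 * a + _ - _ + _ in drift *.
set G := expR (- (beta * v ^+ 2)) * _ in gain.
have -> : N%:R * (D - G) = N%:R * D - N%:R * G.
  by rewrite mulrBr.
have w1 : 1 <= w by lra.
have : (2 + C1 + C0) * w <= w * w by rewrite ler_wpM2r//; lra.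
have : C0 <= C0 * w by rewrite ler_peMr.
rewrite expr2 in gain.
lra.
Qed.

End large_N.

Theorem theorem1 (R : realType) (lambda1 lambda2 beta nu : R) (c : nat -> R)
    (d : nat -> measure_display) (T : forall N : nat, measurableType (d N))
    (P0 Pmu : forall N : nat, probability (T N) R)
    (Z : forall N : nat, 'I_N -> {mfun T N >-> R})
    (hlambda1 : 0 <= lambda1) (hlambda2 : 0 < lambda2)
    (hbeta0 : 1 / 2 < beta) (hbeta1 : beta < 1)
    (hnu : rhoZ beta < nu)
    (hc : c N @[N --> \oo] --> +oo)
    (hco : forall delta : R, 0 < delta ->
       c =o_\oo (fun N : nat => (N%:R : R) `^ delta))
    (hH0 : forall N : nat, iid (P0 N) (Z N) (normal_prob 0 1))
    (hH1 : forall N : nat,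
       iid (Pmu N) (Z N)
         (normal_mixture_law (N%:R `^ (- beta)) (Num.sqrt (2 * nu * ln N%:R)))) :
  (P0 N [set w | (c N <= score lambda1 lambda2 (pvalue (Z N ^~ w)))%R]
     + Pmu N [set w | (score lambda1 lambda2 (pvalue (Z N ^~ w)) < c N)%R])%E
    @[N --> \oo] --> 0%E.
Proof.
have [s [r [s01 r0 snu eta0]]] := detection_exponent hbeta0 hbeta1 hnu.
set eta := _ - _ - _ in eta0.
have nu0 : 0 <= nu.
  apply: le_trans (ltW hnu); rewrite /rhoZ; case: ifP => _; last exact: sqr_ge0.
  lra.
pose v N := Num.sqrt (ln (N%:R : R)).
pose w N := expR (eta * v N ^+ 2 / 4).
have near_v := @near_le_sqrt_ln R.
have near_w K : \forall N \near \oo, K <= w N.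
  near=> N; apply: (le_trans _ (expR_ge1Dx _)).
  have v1 : 1 <= v N by near: N; exact: near_v.
  have vK : 4 * K / eta <= v N by near: N; exact: near_v.
  have vv : v N <= v N ^+ 2 by rewrite expr2 ler_peMr// (le_trans ler01).
  have := le_trans vK vv; rewrite ler_pdivrMr//; lra.
have near_c K : \forall N \near \oo, K <= c N by move/cvgryPge : hc; exact.
apply: (@squeeze_cvge _ _ _ _ (cst 0%E) _
    (fun N => (expR (- c N) + expR (- w N))%:E)); last 2 first.
- exact: cvg_cst.
- apply: cvg_EFin; first exact: nearW.
  rewrite (_ : _ \o _ = fun N => expR (- c N) + expR (- w N))//.
  rewrite -[X in _ --> X](addr0 (0 : R)).
  by apply: cvgD; exact: cvg_expRN_ge.
have eta4 : 0 < eta / 4 by rewrite divr_gt0.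
near=> N.
have N2 : 1 <= ln (N%:R : R) by near: N; exact: near_le_ln.
have vE : v N ^+ 2 = ln (N%:R : R) by rewrite sqr_sqrtr// (le_trans ler01).
have N0 : 0 < (N%:R : R).
  by rewrite ltNge; apply/negP => N0; move: N2; rewrite ln0// ler10.
have v1 : 1 <= v N by near: N; exact: near_v.
have vl2 : 8 * lambda2 <= v N by near: N; exact: near_v.
have vl1 : 4 * lambda1 <= v N ^+ 2 by rewrite vE; near: N; exact: near_le_ln.
have cw : c N <= w N.
  suff : `|c N| <= 1 * `|N%:R `^ (eta / 4)|.
    rewrite mul1r (ger0_norm (powR_ge0 _ _)) => cN.
    apply: le_trans (ler_norm _) (le_trans cN _).
    by rewrite /powR gt_eqF// /w vE ler_expR; lra.
  near: N.
  by have /eqoP := hco _ eta4; apply.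
have [_ _ _ [a0 b0 ab _]] := score_weights hlambda1 hlambda2 v1 vl2 vl1.
rewrite adde_ge0//= EFinD leeD//.
  apply: size_le => //; lra.
apply: (@power_at_boundary R _ _ (Pmu N) N (Z N) lambda1 lambda2 beta nu s r
  (c N) (hH1 N)) => //; last by near: N; exact: near_w.
rewrite -/eta -/(v N); set A := r * _ + 1; set B := ln _.
have vAB : 2 * (A + 1 + `|B|) / eta <= v N by near: N; exact: near_v.
rewrite ler_pdivrMr// in vAB.
have vB : - B <= `|B| * v N.
  by apply: le_trans (ler_norm _) _; rewrite normrN ler_peMr.
have := ler_wpM2r (le_trans ler01 v1) vAB.
lra.
Unshelve. all: by end_near. Qed.
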